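(* Let $\mu\in\mathcal{P}(\Theta)$ and let $(\mu_k)_{k\ge1}\subseteq\mathcal{P}(\Theta)$ converge weakly to $\mu$. Let $\bar x_0\colon\Theta\to X$ be measurable. Assume the following. (1) There exist $\alpha_x,\alpha_u\in\mathcal{K}_\infty$ such that for all $\theta\in\Theta$, $x,x'\in X$, $u,u'\in U$: $d_X(f(x,u,\theta),f(x',u',\theta))\le \alpha_x(d_X(x,x'))+\alpha_u(d_U(u,u'))$. (2) (i) There exist $\gamma_x,\gamma_u\in\mathcal{K}_\infty$ such that $|\ell_0(x,u,\theta)-\ell_0(x',u',\theta)|\le\gamma_x(d_X(x,x'))+\gamma_u(d_U(u,u'))$ for all $x,x'\in X$, $u,u'\in U$, $\theta\in\Theta$; (ii) $\ell_u$ is lower semicontinuous; (iii) there exists $\gamma_N\in\mathcal{K}_\infty$ such that $|F_N(x,\theta)-F_N(x',\theta)|\le\gamma_N(d_X(x,x'))$ for all $x,x'\in X$, $\theta\in\Theta$. (3) The maps $\bar x_0$, $f$, $\ell_0$ and $F_N$ are continuous. (4) For all $\underline{u}\in U^N$ and $n=0,\dots,N-1$, $$\lim_{k}\int_\Theta\ell_0(\phi_{\underline{u}}^\theta(n),\underline{u}(n),\theta)\,\mathrm{d}\mu_k(\theta)=\int_\Theta\ell_0(\phi_{\underline{u}}^\theta(n),\underline{u}(n),\theta)\,\mathrm{d}\mu(\theta),$$ and $$\lim_k\int_\Theta F_N(\phi_{\underline{u}}^\theta(N),\theta)\,\mathrm{d}\mu_k(\theta)=\int_\Theta F_N(\phi_{\underline{u}}^\theta(N),\theta)\,\mathrm{d}\mu(\theta).$$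 (5) There exists a coercive function $r\colon U\to\mathbb{R}_{\ge0}$ such that $\ell(x,u,\theta)\ge r(u)$ for all $x\in X$, $u\in U$, $\theta\in\Theta$. Then $$\inf_{\underline{u}\in U^N}\bar J_N(\bar x_0,\underline{u},\mu)=\lim_k\inf_{\underline{u}\in U^N}\bar J_N(\bar x_0,\underline{u},\mu_k).$$ Furthermore, for each $k\ge1$ the map $\underline{u}\mapsto\bar J_N(\bar x_0,\underline{u},\mu_k)$ has a minimiser, and if $\underline{u}^{(k)}\in U^N$ is any minimiser of it for each $k\ge1$, then the sequence $(\underline{u}^{(k)})_k$ is precompact in $U^N$ (product topology), and any limit point $\underline{u}^\ast\in U^N$ of this sequence (limit of a convergent subsequence) is a minimiser of $\underline{u}\mapsto\bar J_N(\bar x_0,\underline{u},\mu)$.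
   Context: $(X,d_X)$, $(U,d_U)$, $(\Theta,d_\Theta)$ are metric spaces with their Borel $\sigma$-algebras; $\mathcal{P}(\Theta)$ is the set of Borel probability measures on $\Theta$; $N\ge1$ is an integer. $\mu_k$ converges weakly to $\mu$ if $\int\varphi\,\mathrm{d}\mu_k\to\int\varphi\,\mathrm{d}\mu$ for all bounded continuous $\varphi\colon\Theta\to\mathbb{R}$. $f\colon X\times U\times\Theta\to X$ is a transition function. The stage cost $\ell\colon X\times U\times\Theta\to\mathbb{R}_{\ge0}$ has the form $\ell(x,u,\theta)=\ell_u(u)+\ell_0(x,u,\theta)$ with $\ell_u\colon U\to\mathbb{R}_{\ge0}$, $\ell_0\colon X\times U\times\Theta\to\mathbb{R}_{\ge0}$; the terminal cost is $F_N\colon X\times\Theta\to\mathbb{R}_{\ge0}$. For $x_0\in X$, $\theta\in\Theta$ and $\underline{u}=(\underline{u}(0),\dots,\underline{u}(N-1))\in U^N$, the trajectory is defined by $\phi_{\underline{u},x_0}^\theta(0)=x_0$, $\phi_{\underline{u},x_0}^\theta(n+1)=f(\phi_{\underline{u},x_0}^\theta(n),\underline{u}(n),\theta)$ for $0\le n<N$; given $\bar x_0\colon\Theta\to X$, write $\phi_{\underline{u}}^\theta(n)=\phi_{\underline{u},\bar x_0(\theta)}^\theta(n)$. The total cost is $$J_N(x_0,\underline{u},\theta)=\sum_{n=0}^{N-1}\ell(\phi_{\underline{u},x_0}^\theta(n),\underline{u}(n),\theta)+F_N(\phi_{\underline{u},x_0}^\theta(N),\theta),$$ and for $\nu\in\mathcal{P}(\Theta)$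 the averaged cost is $\bar J_N(\bar x_0,\underline{u},\nu)=\int_\Theta J_N(\bar x_0(\theta),\underline{u},\theta)\,\mathrm{d}\nu(\theta)\in\mathbb{R}_{\ge0}\cup\{\infty\}$. $\mathcal{K}_\infty$ is the set of continuous, strictly increasing $\alpha\colon\mathbb{R}_{\ge0}\to\mathbb{R}_{\ge0}$ with $\alpha(0)=0$ and $\lim_{r\to\infty}\alpha(r)=\infty$. A function $g\colon Z\to\mathbb{R}\cup\{\infty\}$ on a metric space is lower semicontinuous if $g(z)\le\liminf_k g(z_k)$ whenever $z_k\to z$; it is coercive if for all $t\in\mathbb{R}$ the set $\{z\in Z\mid g(z)<t\}$ is precompact. Precompact means having compact closure in the ambient space; a sequence is precompact if its set of values is.
   Formalization: Precompactness of the minimiser sequence is stated only when the infimum of the averaged cost under μ is finite; this is automatic if the limits in (4) are real, and precompactness can fail when both sides of (4) are infinite. *)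

(* Defs.v *)
(* MathComp / MathComp-Analysis *)
From HB Require Import structures.
From mathcomp Require Import all_boot all_order all_algebra.
From mathcomp Require Import all_classical all_reals all_analysis.

Set Implicit Arguments.
Unset Strict Implicit.
Unset Printing Implicit Defensive.

Import Order.TTheory GRing.Theory Num.Theory.
Import numFieldNormedType.Exports.

Local Open Scope classical_set_scope.
Local Open Scope ring_scope.

(* Nonempty metric spaces; the distinguished point is only there because
   the library's measurable types are pointed. *)
#[short(type="pmetricType")]
HB.structure Definition PointedMetric (K : numDomainType) :=
  { M of Metric K M & Pointed M }.

(* T with its Borel sigma-algebra; as a bare type this is T itself. *)
Notation borel T := (g_sigma_algebraType (@open T)).

Section comparison_functions.
Context {R : realType}.

(* A function on [0, +oo[ is represented by a function on R, of which only
   the values on [0, +oo[ matter. *)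
Definition class_Kinfty (a : R -> R) : Prop :=
  [/\ a 0 = 0,
      {in `[0, +oo[ &, {homo a : s t / s < t}},
      {within [set` `[0, +oo[], continuous a} &
      a s @[s --> +oo] --> +oo].

End comparison_functions.

Section variational_notions.
Context {R : realType}.

Definition coercive {Z : topologicalType} (g : Z -> \bar R) : Prop :=
  forall t : R, precompact [set z | (g z < t%:E)%E].

Definition minimiser {Z : Type} (g : Z -> \bar R) (z : Z) : Prop :=
  forall z', (g z <= g z')%E.

Definition subseq_limit {Z : topologicalType} (z_ : nat -> Z) (z : Z) : Prop :=
  exists2 s : nat -> nat,
    {homo s : i j / (i < j)%N} & z_ (s k) @[k --> \oo] --> z.

Definition weak_cvg {Theta : pmetricType R}
    (mu_ : nat -> probability (borel Theta) R)
    (mu : probability (borel Theta) R) : Prop :=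
  forall phi : Theta -> R, continuous phi ->
    (exists M : R, forall th, `|phi th| <= M) ->
    (\int[mu_ k]_th (phi th)%:E)%E @[k --> \oo] --> (\int[mu]_th (phi th)%:E)%E.

End variational_notions.

Section optimal_control.
Context {R : realType} {X U Theta : pmetricType R}.
Variables (f : X * U * Theta -> X).
Variables (lu : U -> R) (l0 : X * U * Theta -> R) (F : X * Theta -> R).
Context {N : nat}.
Implicit Types (u : {ptws 'I_N -> U}) (x : X) (th : Theta).

(* [insub n] is the index n : 'I_N when n < N; the trajectory is only
   meaningful up to time N and is frozen afterwards. *)
Fixpoint traj u x th (n : nat) : X :=
  if n is m.+1 then
    if insub m is Some i then f (traj u x th m, u i, th) else traj u x th m
  else x.

Definition stage_cost (z : X * U * Theta) : R := lu z.1.2 + l0 z.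

Definition total_cost x u th : R :=
  \sum_(n < N) stage_cost (traj u x th n, u n, th) + F (traj u x th N, th).

Definition avg_cost (xbar0 : Theta -> X) u
    (nu : probability (borel Theta) R) : \bar R :=
  (\int[nu]_th (total_cost (xbar0 th) u th)%:E)%E.

End optimal_control.

(* Main.v *)
(* The averaged costs J(mu_k, .) Gamma-converge to J(mu, .) and are
   equicoercive. By the moduli of continuity, the trajectory, and hence the
   running and terminal costs, depend on the inputs uniformly in theta and in
   the initial state; so the integrals of these costs are continuous in the
   inputs uniformly over all probability measures. With the lower
   semicontinuity of the input cost and the convergence (4) for fixed inputs,
   this gives the liminf inequality, and (4) makes constant sequences recovery
   sequences. Since J(nu, u) >= r(u(n)) for all nu and n, the sublevel sets
   lie in a product of compact sets that does not depend on nu. Weak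
   convergence enters only through (4). *)
Require Import Defs.
From HB Require Import structures.
From mathcomp Require Import all_boot all_order all_algebra.
From mathcomp Require Import all_classical all_reals all_analysis.
From mathcomp Require Import measurable_realfun.

Import Order.TTheory GRing.Theory Num.Theory.
Import numFieldNormedType.Exports.

Local Open Scope classical_set_scope.
Local Open Scope ring_scope.

(** * Order criteria for limits in the extended reals *)

Lemma ereal_dense_fin {R : realType} {a : R} {y : \bar R} :
  (a%:E < y)%E -> exists2 b : R, a < b & (b%:E < y)%E.
Proof.
case: y => [y| _ |//].
- rewrite lte_fin => ay; exists ((a + y) / 2); rewrite ?lte_fin.
  + by rewrite midf_lt.
  + by rewrite midf_lt.
- by exists (a + 1); rewrite ?ltrDl ?ltry.
Qed.

(** At an infinite limit one of the two hypotheses is vacuous, so finite and infinite limits are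
    covered by one criterion. *)
Lemma cvge_orderP {R : realType} {I : Type} {F : set_system I} {FF : Filter F}
    (g : I -> \bar R) (l : \bar R) :
  (forall a : R, (a%:E < l)%E -> \forall i \near F, (a%:E < g i)%E) ->
  (forall b : R, (l < b%:E)%E -> \forall i \near F, (g i < b%:E)%E) ->
  g i @[i --> F] --> l.
Proof.
case: l => [r| |] lo up.
- apply/fine_cvgP; split.
    have := lo (r - 1); have := up (r + 1).
    rewrite !lte_fin ltrDl gtrBl ltr01 => /(_ isT) h1 /(_ isT) h2.
    near=> i => /=.
    rewrite fin_real//; apply/andP; split.
      by rewrite (@lt_trans _ _ (r - 1)%:E)// ?ltNyr//; near: i.
    by rewrite (@lt_trans _ _ (r + 1)%:E)// ?ltry//; near: i.
  apply/cvgrPdist_lt => e e0.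
  have := lo (r - e); have := up (r + e).
  rewrite !lte_fin ltrDl gtrBl e0 => /(_ isT) h1 /(_ isT) h2.
  near=> i => /=.
  have : (g i < (r + e)%:E)%E by near: i.
  have : ((r - e)%:E < g i)%E by near: i.
  case: (g i) => //= s; rewrite !lte_fin => ? ?.
  by rewrite ltr_distlC; apply/andP; split.
- by apply/cvgeyPgt => A; apply: lo; rewrite ltry.
- by apply/cvgeNyPlt => A; apply: up; rewrite ltNyr.
Unshelve. all: by end_near. Qed.

Lemma cvge_gt_near {R : realType} {I : Type} {F : set_system I} {FF : Filter F}
    {g : I -> \bar R} {l : \bar R} {a : R} :
  g i @[i --> F] --> l -> (a%:E < l)%E -> \forall i \near F, (a%:E < g i)%E.
Proof.
move=> gl al; apply: (gl [set x | (a%:E < x)%E]).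
by apply: open_nbhs_nbhs; split; [exact: open_ereal_gt_ereal|].
Qed.

Lemma cvge_lt_near {R : realType} {I : Type} {F : set_system I} {FF : Filter F}
    {g : I -> \bar R} {l : \bar R} {a : R} :
  g i @[i --> F] --> l -> (l < a%:E)%E -> \forall i \near F, (g i < a%:E)%E.
Proof.
move=> gl al; apply: (gl [set x | (x < a%:E)%E]).
by apply: open_nbhs_nbhs; split; [exact: open_ereal_lt_ereal|].
Qed.

(** * The direct method, and convergence of infima and minimisers *)

Section variational_limit.
Context {R : realType} {Z : topologicalType}.

(** The direct method without sequences: were a finite infimum [r] not attained, compactness would
    give a bound [a > r] on all of [K], while outside [K] the values are at least [r + 1]. *)
Lemma lsc_coercive_minimiser (g : Z -> \bar R) (z0 : Z) :
  lower_semicontinuous g -> (forall z, (0 <= g z)%E) ->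
  (forall t : R, exists2 K, compact K & forall z, (g z < t%:E)%E -> K z) ->
  exists z, minimiser g z.
Proof.
move=> glsc g0 gco.
have := @ereal_inf_lbound _ (range g).
have : (0 <= ereal_inf (range g))%E.
  by apply: le_ereal_inf_tmp => _ [z _ <-].
case E : (ereal_inf (range g)) => [r| |] // _ lb; last first.
  exists z0 => z; apply: le_trans (leey _) _.
  by apply: lb; exists z.
apply: contrapT => nomin.
have gtr z : (r%:E < g z)%E.
  rewrite ltNge; apply/negP => gzr; apply: nomin; exists z => z'.
  by apply: le_trans gzr _; apply: lb; exists z'.
have [K /compact_near_coveringP cK gK] := gco (r + 1).
(* Lower semicontinuity gives a bound [b > r] near each point; letting [a] decrease to [r] merges
   these local bounds into one on [K]. *)
have /(cK _ (r^'+)) : forall z, K z ->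
    \forall z' \near z & a \near r^'+, (a%:E < g z')%E.
  move=> z _; have [b rb bz] := ereal_dense_fin (gtr z).
  have [V Vz Vb] := glsc _ _ bz.
  exists (V, [set a | a < b]); first by split => //; exact: nbhs_right_lt.
  by move=> [z' a] [/= Vz' ab]; apply: lt_trans (Vb _ Vz'); rewrite lte_fin.
move=> Ka.
have [a [ra ar1 aK]] : exists a, [/\ r < a, a < r + 1 &
    K `<=` fun z => (a%:E < g z)%E].
  near (r^'+)%R => a; exists a; split.
  - by near: a; exact: nbhs_right_gt.
  - by near: a; apply: nbhs_right_lt; rewrite ltrDl.
  - by near: a.
have : (a%:E <= ereal_inf (range g))%E.
  apply: le_ereal_inf_tmp => _ [z _ <-]; apply: ltW.
  have [gz|gz] := ltP (g z) (r + 1)%:E; first exact/aK/gK.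
  by apply: lt_le_trans gz; rewrite lte_fin.
by rewrite E lee_fin leNgt ra.
Unshelve. all: by end_near. Qed.

(* The hypotheses say that g_ Gamma-converges to g, with constant recovery
   sequences, and is equicoercive. *)
Variables (g_ : nat -> Z -> \bar R) (g : Z -> \bar R).
Hypothesis liminf_g : forall z (a : R), (a%:E < g z)%E ->
  \forall z' \near z & k \near \oo, (a%:E < g_ k z')%E.
Hypothesis cvg_g : forall z, g_ k z @[k --> \oo] --> g z.
Hypothesis coercive_g : forall t : R,
  exists2 K, compact K & forall k z, (g_ k z < t%:E)%E -> K z.

(** From below, a level [b] under the infimum of [g] is exceeded by [g_ k] on [K] for large [k], by
    compactness, and off [K] the values are at least [b] anyway. From above, a point almost optimal
    for [g] is tested in every [g_ k]. *)
Lemma inf_cvg :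
  ereal_inf (range (g_ k)) @[k --> \oo] --> ereal_inf (range g).
Proof.
apply: cvge_orderP => a.
- move=> /ereal_dense_fin[b ab bg].
  have [K /compact_near_coveringP cK gK] := coercive_g b.
  have /(cK _ \oo) Ka : forall z, K z ->
      \forall z' \near z & k \near \oo, (b%:E < g_ k z')%E.
    move=> z _; apply: liminf_g; apply: lt_le_trans bg _.
    by apply: ereal_inf_lbound; exists z.
  near=> k; apply: (@lt_le_trans _ _ b%:E); first by rewrite lte_fin.
  apply: le_ereal_inf_tmp => _ [z _ <-].
  rewrite leNgt; apply/negP => gkb.
  have : K `<=` (fun z => (b%:E < g_ k z)%E) by near: k.
  by move=> /(_ z (gK _ _ gkb)); rewrite ltNge (ltW gkb).
- move=> /ereal_inf_lt[_ [z _ <-]] gza.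
  near=> k; apply: (@le_lt_trans _ _ (g_ k z)).
    by apply: ereal_inf_lbound; exists z.
  by near: k; apply: cvge_lt_near gza.
Unshelve. all: by end_near. Qed.

Variable z_ : nat -> Z.
Hypothesis min_z : forall k, minimiser (g_ k) (z_ k).

Lemma minimiser_inf k : g_ k (z_ k) = ereal_inf (range (g_ k)).
Proof.
apply/eqP; rewrite eq_le; apply/andP; split.
  by apply: le_ereal_inf_tmp => _ [z _ <-]; exact: min_z.
by apply: ereal_inf_lbound; exists (z_ k).
Qed.

(** The minimal values converge to a limit below some real [t], so a tail of the minimisers lies in
    one sublevel compact; the remaining terms are finitely many. *)
Lemma minimisers_precompact : hausdorff_space Z ->
  (ereal_inf (range g) < +oo)%E -> precompact (range z_).
Proof.
move=> hZ infoo.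
have [t inft] : exists t : R, (ereal_inf (range g) < t%:E)%E.
  case: (ereal_inf _) infoo => [r _| |_] //; last by exists 0; rewrite ltNyr.
  by exists (r + 1); rewrite lte_fin ltrDl.
have [K cK gK] := coercive_g t.
have [n _ nK] : \forall k \near \oo, K (z_ k).
  near=> k; apply: (gK k); rewrite minimiser_inf.
  by near: k; apply: cvge_lt_near inft; exact: inf_cvg.
apply: (@precompact_subset _ _ (K `|` z_ @` `I_n)).
  move=> _ [k _ <-]; case: (ltnP k n) => kn; [right|left]; last exact: nK.
  by exists k.
apply: compact_precompact => //; apply: compactU => //.
by apply: finite_compact; apply: finite_image; exact: finite_II.
Unshelve. all: by end_near. Qed.

(** A real level [a] strictly between the infimum of [g] and [g z] would lie above the minimal
    values along the subsequence, by [inf_cvg], and below them, by [liminf_g] at [z]. *)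
Lemma subseq_limit_minimiser z : subseq_limit z_ z -> minimiser g z.
Proof.
move=> [s s_incr zs] z'.
apply: (@le_trans _ _ (ereal_inf (range g))); last first.
  by apply: ereal_inf_lbound; exists z'.
rewrite leNgt; apply/negP => infz.
have [a infa az] : exists2 a : R,
    (ereal_inf (range g) < a%:E)%E & (a%:E < g z)%E.
  case: (ereal_inf _) infz => [r| |].
  - exact: ereal_dense_fin.
  - by rewrite ltNge leey.
  - case: (g z) => [r _| _ |]; last by rewrite ltxx.
      by exists (r - 1); rewrite ?ltNyr ?lte_fin ?gtrBl.
    by exists 0; rewrite ?ltNyr ?ltry.
(* Strict monotonicity gives [k <= s k]. *)
have s_oo : s k @[k --> \oo] --> \oo.
  move=> A [n _ nA]; exists n => // k /= nk; apply: nA => /=.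
  apply: leq_trans nk _; elim: k => // k; move/leq_ltn_trans; apply.
  exact: s_incr.
have h1 : \forall k \near \oo, (g_ (s k) (z_ (s k)) < a%:E)%E.
  apply: (s_oo (fun k => (g_ k (z_ k) < a%:E)%E)); near=> k.
  rewrite minimiser_inf; near: k; apply: cvge_lt_near infa; exact: inf_cvg.
have h2 : \forall k \near \oo, (a%:E < g_ (s k) (z_ (s k)))%E.
  have [[V W] [/= Vz Wo] VW] := liminf_g _ _ az.
  near=> k; apply: (VW (_, _)); split => /=; near: k; first exact: zs.
  exact: s_oo.
near \oo => k.
have : (g_ (s k) (z_ (s k)) < a%:E)%E by near: k.
by apply/negP; rewrite -leNgt; apply: ltW; near: k.
Unshelve. all: by end_near. Qed.

End variational_limit.

(** * Smallness of moduli near zero, and Borel measurability *)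

Lemma class_Kinfty_lt {R : realType} {a : R -> R} {e : R} :
  class_Kinfty a -> 0 < e ->
  exists2 d : R, 0 < d & forall s, 0 <= s -> s < d -> a s < e.
Proof.
move=> [a0 _ /continuous_within_itvcyP[_]]; rewrite a0 => a_cvg _ e0.
have [d /= d0 da] := cvgr_lt _ a_cvg _ e0.
(* The right limit at 0 says nothing about [s = 0], where [a 0 = 0] is used. *)
exists d => // s; rewrite le_eqVlt => /predU1P[<-|s0 sd]; first by rewrite a0.
by apply: da => //=; rewrite sub0r normrN gtr0_norm.
Qed.

Lemma modulus_lt {R : realType} {a b : R -> R} {e : R} :
  class_Kinfty a -> class_Kinfty b -> 0 < e ->
  exists2 d : R, 0 < d &
    forall s t, 0 <= s -> s < d -> 0 <= t -> t < d -> a s + b t < e.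
Proof.
move=> Ka Kb e0; have e2 : 0 < e / 2 by rewrite divr_gt0.
have [d1 d1_gt0 ad] := class_Kinfty_lt Ka e2.
have [d2 d2_gt0 bd] := class_Kinfty_lt Kb e2.
exists (Num.min d1 d2); first by rewrite lt_min d1_gt0.
move=> s t s0 + t0; rewrite !lt_min => /andP[sd _] /andP[_ td].
by rewrite (splitr e) ltrD ?ad ?bd.
Qed.

Lemma continuous_borel_measurable {R : realType} {T : pmetricType R}
    {h : T -> R} :
  continuous h -> measurable_fun setT (h : borel T -> R).
Proof.
move=> /continuousP ch; apply: (measurability _ (RGenOpens.measurableE R)).
move=> _ [_ [a [b ->] <-]]; rewrite setTI; apply: sub_sigma_algebra.
exact/ch/interval_open.
Qed.

(** * Dependence of trajectories and costs on the inputs, uniform in the parameter *)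

Section averaged_cost.
Context {R : realType} {X U Theta : pmetricType R} {N : nat}.
Variables (f : X * U * Theta -> X).
Variables (lu : U -> R) (l0 : X * U * Theta -> R) (F : X * Theta -> R).
Hypothesis lu_ge0 : forall u, 0 <= lu u.
Hypothesis l0_ge0 : forall z, 0 <= l0 z.
Hypothesis F_ge0 : forall z, 0 <= F z.
Hypothesis f_mod : exists ax au : R -> R, [/\ class_Kinfty ax, class_Kinfty au &
  forall th x x' u u', mdist (f (x, u, th)) (f (x', u', th))
                       <= ax (mdist x x') + au (mdist u u')].
Hypothesis l0_mod : exists gx gu : R -> R,
  [/\ class_Kinfty gx, class_Kinfty gu &
  forall x x' u u' th, `|l0 (x, u, th) - l0 (x', u', th)|
                       <= gx (mdist x x') + gu (mdist u u')].
Hypothesis lu_lsc : lower_semicontinuous (EFin \o lu).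
Hypothesis F_mod : exists2 gN : R -> R, class_Kinfty gN &
  forall x x' th, `|F (x, th) - F (x', th)| <= gN (mdist x x').
Implicit Types (u v : {ptws 'I_N -> U}).

Lemma near_coord u (i : 'I_N) (P : set U) :
  (\forall z \near u i, P z) -> \forall v \near u, P (v i).
Proof. exact: (@proj_continuous _ (fun=> U) i u). Qed.

Lemma near_mdist u (i : 'I_N) (e : R) :
  0 < e -> \forall v \near u, mdist (u i) (v i) < e.
Proof.
move=> e0; apply: (@near_coord u i (fun z => mdist (u i) z < e)).
by have := nbhsx_ballx (u i) _ e0; rewrite ballEmdist.
Qed.

(** By induction on time: the modulus of [f] sees only the distance of the states and that of the
    inputs, so its [d] serves all [x] and [th] at once. *)
Lemma near_traj u n (e : R) : 0 < e -> \forall v \near u, forall x th,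
  mdist (traj f u x th n) (traj f v x th n) < e.
Proof.
elim: n e => [|n IHn] e e0 /=.
  by near=> v => x th; rewrite mdistxx.
case: insubP => [i _ _|_]; last exact: IHn.
have [ax [au [Kax Kau f_le]]] := f_mod.
have [d d0 ad] := modulus_lt Kax Kau e0.
near=> v => x th; apply: (le_lt_trans (f_le _ _ _ _ _)).
apply: ad; rewrite ?mdist_ge0//; last by near: v; exact: near_mdist.
by move: x th; near: v; exact: IHn.
Unshelve. all: by end_near. Qed.

(** The total cost is split into this part, which is only lower semicontinuous but free of [th], and
    [run_cost], which is continuous in the inputs uniformly in [x] and [th]. *)
Definition input_cost u : R := \sum_(n < N) lu (u n).

Definition run_cost u (x : X) th : R :=
  \sum_(n < N) l0 (traj f u x th n, u n, th) + F (traj f u x th N, th).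

Lemma total_costE u x th :
  total_cost f lu l0 F x u th = input_cost u + run_cost u x th.
Proof. by rewrite /total_cost big_split /= -addrA. Qed.

Lemma near_l0 u (n : 'I_N) (e : R) : 0 < e -> \forall v \near u, forall x th,
  `|l0 (traj f u x th n, u n, th) - l0 (traj f v x th n, v n, th)| < e.
Proof.
move=> e0; have [gx [gu [Kgx Kgu l0_le]]] := l0_mod.
have [d d0 ad] := modulus_lt Kgx Kgu e0.
near=> v => x th; apply: (le_lt_trans (l0_le _ _ _ _ _)).
apply: ad; rewrite ?mdist_ge0//; last by near: v; exact: near_mdist.
by move: x th; near: v; exact: near_traj.
Unshelve. all: by end_near. Qed.

Lemma near_F u (e : R) : 0 < e -> \forall v \near u, forall x th,
  `|F (traj f u x th N, th) - F (traj f v x th N, th)| < e.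
Proof.
move=> e0; have [gN KgN F_le] := F_mod.
have [d d0 ad] := class_Kinfty_lt KgN e0.
near=> v => x th; apply: (le_lt_trans (F_le _ _ _)).
apply: ad; rewrite ?mdist_ge0//.
by move: x th; near: v; exact: near_traj.
Unshelve. all: by end_near. Qed.

Lemma near_run_cost u (e : R) : 0 < e -> \forall v \near u, forall x th,
  run_cost u x th <= run_cost v x th + e.
Proof.
(* The error [e] is shared equally among the [N] running costs and the terminal cost. *)
move=> e0; have d0 : 0 < e / N.+1%:R by rewrite divr_gt0.
have near_sum : \forall v \near u, forall n : 'I_N, forall x th,
    `|l0 (traj f u x th n, u n, th) - l0 (traj f v x th n, v n, th)|
    < e / N.+1%:R.
  by apply: (@filter_forall _ _ _ (nbhs u)) => n; exact: near_l0.
near=> v => x th.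
have -> : e = \sum_(n < N) e / N.+1%:R + e / N.+1%:R.
  by rewrite sumr_const card_ord -mulrSr -[RHS]mulr_natr divfK.
rewrite addrACA -big_split /= lerD ?ler_sum//.
- move=> n _; rewrite -lerBlDl; apply: ltW; apply: le_lt_trans (ler_norm _) _.
  by move: n x th; near: v.
- rewrite -lerBlDl; apply: ltW; apply: le_lt_trans (ler_norm _) _.
  by move: x th; near: v; exact: near_F.
Unshelve. all: by end_near. Qed.

Lemma run_cost_ge0 u x th : 0 <= run_cost u x th.
Proof. by rewrite addr_ge0// sumr_ge0. Qed.

(** * Measurability, and integration against a probability measure *)

Variable xbar0 : Theta -> X.
Hypotheses (xbar0_cont : continuous xbar0) (f_cont : continuous f).
Hypotheses (l0_cont : continuous l0) (F_cont : continuous F).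

Lemma traj_continuous u n : continuous (fun th => traj f u (xbar0 th) th n).
Proof.
elim: n => [|n IHn] //= th; case: insubP => [i _ _|_]; last exact: IHn.
apply: (@continuous_comp _ _ _
  (fun th => (traj f u (xbar0 th) th n, u i, th)) f);
  last exact: f_cont.
exact: (cvg_pair (cvg_pair (IHn th) (cvg_cst _)) cvg_id).
Qed.

Lemma measurable_l0_traj u (n : 'I_N) : measurable_fun setT
  (fun th : borel Theta => l0 (traj f u (xbar0 th) th n, u n, th)).
Proof.
apply: continuous_borel_measurable => th.
apply: (@continuous_comp _ _ _
  (fun th => (traj f u (xbar0 th) th n, u n, th)) l0);
  last exact: l0_cont.
exact: (cvg_pair (cvg_pair (traj_continuous u n th) (cvg_cst _)) cvg_id).
Qed.

Lemma measurable_F_traj u : measurable_fun setT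
  (fun th : borel Theta => F (traj f u (xbar0 th) th N, th)).
Proof.
apply: continuous_borel_measurable => th.
apply: (@continuous_comp _ _ _ (fun th => (traj f u (xbar0 th) th N, th)) F);
  last exact: F_cont.
exact: (cvg_pair (traj_continuous u N th) cvg_id).
Qed.

Lemma measurable_run_cost u : measurable_fun setT
  (fun th : borel Theta => run_cost u (xbar0 th) th).
Proof.
apply: measurable_funD; last exact: measurable_F_traj.
by apply: measurable_sum => n; exact: measurable_l0_traj.
Qed.

Implicit Types (nu : probability (borel Theta) R).

Definition avg_run_cost nu u : \bar R :=
  (\int[nu]_th (run_cost u (xbar0 th) th)%:E)%E.

(** This separates the integrals whose convergence is assumed; nonnegativity allows it even when
    they are infinite. *)
Lemma avg_run_costE nu u : avg_run_cost nu u =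
  (\sum_(n < N) \int[nu]_th (l0 (traj f u (xbar0 th) th n, u n, th))%:E
   + \int[nu]_th (F (traj f u (xbar0 th) th N, th))%:E)%E.
Proof.
rewrite -ge0_integral_sum//; last 2 first.
- by move=> n; apply/measurable_EFinP; exact: measurable_l0_traj.
- by move=> n th _; rewrite lee_fin.
rewrite -ge0_integralD//.
- by apply: eq_integral => th _; rewrite sumEFin -EFinD.
- by move=> th _; rewrite sume_ge0// => n _; rewrite lee_fin.
- apply: emeasurable_sum => n; apply/measurable_EFinP.
  exact: measurable_l0_traj.
- by move=> th _; rewrite lee_fin.
- by apply/measurable_EFinP; exact: measurable_F_traj.
Qed.

Lemma avg_run_cost_ge0 nu u : (0 <= avg_run_cost nu u)%E.
Proof.
by apply: integral_ge0 => th _; rewrite lee_fin run_cost_ge0.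
Qed.

(** The pointwise bound is integrated: the neighbourhood is fixed before [nu], and total mass 1
    keeps the error at [e]. *)
Lemma near_avg_run_cost u (e : R) : 0 < e -> \forall v \near u, forall nu,
  (avg_run_cost nu u <= avg_run_cost nu v + e%:E)%E.
Proof.
move=> e0; near=> v => nu.
have -> : (e%:E = \int[nu]_th (cst e%:E th))%E.
  by rewrite integral_cst// [X in (_ * X)%E]probability_setT mule1.
rewrite -ge0_integralD//; last 3 first.
- by move=> th _; rewrite lee_fin run_cost_ge0.
- by apply/measurable_EFinP; exact: measurable_run_cost.
- by move=> th _; rewrite lee_fin ltW.
apply: ge0_le_integral => //.
- by move=> th _; rewrite lee_fin run_cost_ge0.
- by apply/measurable_EFinP; exact: measurable_run_cost.
- apply/measurable_EFinP; apply: measurable_funD => //.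
  exact: measurable_run_cost.
- move=> th _; rewrite lee_fin; move: (xbar0 th) => x; move: x th.
  by near: v; exact: near_run_cost.
Unshelve. all: by end_near. Qed.

Lemma avg_costE nu u : avg_cost f lu l0 F xbar0 u nu =
  ((input_cost u)%:E + avg_run_cost nu u)%E.
Proof.
have -> : ((input_cost u)%:E
    = \int[nu]_th (cst (input_cost u)%:E th))%E.
  by rewrite integral_cst// [X in (_ * X)%E]probability_setT mule1.
rewrite -ge0_integralD//.
- by apply: eq_integral => th _; rewrite total_costE EFinD.
- by move=> th _; rewrite lee_fin sumr_ge0.
- by move=> th _; rewrite lee_fin run_cost_ge0.
- by apply/measurable_EFinP; exact: measurable_run_cost.
Qed.

Lemma avg_cost_ge0 nu u : (0 <= avg_cost f lu l0 F xbar0 u nu)%E.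
Proof.
by rewrite avg_costE adde_ge0 ?avg_run_cost_ge0// lee_fin sumr_ge0.
Qed.

Lemma near_input_cost u (e : R) : 0 < e ->
  \forall v \near u, input_cost u - e < input_cost v.
Proof.
move=> e0; have d0 : 0 < e / N.+1%:R by rewrite divr_gt0.
have near_sum : \forall v \near u, forall n : 'I_N,
    lu (u n) - e / N.+1%:R < lu (v n).
  apply: (@filter_forall _ _ _ (nbhs u)) => n.
  have [|V Vu Vlt] := @lu_lsc (u n) (lu (u n) - e / N.+1%:R).
    by rewrite lte_fin gtrBl.
  apply: (@near_coord u n (fun z => lu (u n) - e / N.+1%:R < lu z)).
  by apply: filterS Vu => z /Vlt; rewrite lte_fin.
near=> v; apply: (@lt_le_trans _ _ (\sum_(n < N) (lu (u n) - e / N.+1%:R))).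
  (* The total loss is [N * (e / (N + 1))], which is strictly less than [e]. *)
  rewrite sumrB ltrD2l ltrN2 sumr_const card_ord.
  rewrite -[ltLHS]mulr_natr -mulrA gtr_pMr//.
  by rewrite mulrC ltr_pdivrMr// mul1r ltr_nat.
by apply: ler_sum => n _; apply: ltW; move: n; near: v.
Unshelve. all: by end_near. Qed.

(** * Passage to the limit along a sequence of measures *)

Section limit.
Variables (mu : probability (borel Theta) R).
Variables (mu_ : nat -> probability (borel Theta) R).
Hypothesis l0_cvg : forall u (n : 'I_N),
  (\int[mu_ k]_th (l0 (traj f u (xbar0 th) th n, u n, th))%:E)%E
    @[k --> \oo]
  --> (\int[mu]_th (l0 (traj f u (xbar0 th) th n, u n, th))%:E)%E.
Hypothesis F_cvg : forall u,
  (\int[mu_ k]_th (F (traj f u (xbar0 th) th N, th))%:E)%E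
    @[k --> \oo]
  --> (\int[mu]_th (F (traj f u (xbar0 th) th N, th))%:E)%E.

Lemma avg_run_cost_cvg u :
  avg_run_cost (mu_ k) u @[k --> \oo] --> avg_run_cost mu u.
Proof.
rewrite avg_run_costE; under eq_cvg do rewrite avg_run_costE.
apply: cvgeD; last exact: F_cvg.
  apply: ge0_adde_def; rewrite inE.
  - by apply: sume_ge0 => n _; apply: integral_ge0 => th _; rewrite lee_fin.
  - by apply: integral_ge0 => th _; rewrite lee_fin.
apply: cvg_nnesum => n _; last exact: l0_cvg.
by apply: nearW => k; apply: integral_ge0 => th _; rewrite lee_fin.
Qed.

Lemma avg_cost_cvg u :
  avg_cost f lu l0 F xbar0 u (mu_ k) @[k --> \oo]
  --> avg_cost f lu l0 F xbar0 u mu.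
Proof.
rewrite avg_costE; under eq_cvg do rewrite avg_costE.
apply: cvgeD; [exact: fin_num_adde_defr | exact: cvg_cst |].
exact: avg_run_cost_cvg.
Qed.

(** Convergence is used only at the fixed input [u]; the passage to a nearby [v] costs an error
    independent of the measure, so the neighbourhood of [u] does not depend on [k]. *)
Lemma avg_cost_liminf u (a : R) : (a%:E < avg_cost f lu l0 F xbar0 u mu)%E ->
  \forall v \near u & k \near \oo,
    (a%:E < avg_cost f lu l0 F xbar0 v (mu_ k))%E.
Proof.
rewrite avg_costE -lteBlDl// -EFinB => /ereal_dense_fin[c ac cmu].
set L := input_cost u in ac.
(* Half of the slack goes to the input cost and half to the running cost, so that
   [(L - e) + (c - e) = a]. *)
pose e := (L + c - a) / 2.
have e0 : 0 < e by rewrite divr_gt0// subr_gt0 -ltrBlDl.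
have near_k : \forall k \near \oo, (c%:E < avg_run_cost (mu_ k) u)%E.
  by apply: cvge_gt_near cmu; exact: avg_run_cost_cvg.
have near_v : \forall v \near u, L - e < input_cost v /\
    forall nu, (avg_run_cost nu u <= avg_run_cost nu v + e%:E)%E.
  by apply: filterI; [exact: near_input_cost | exact: near_avg_run_cost].
exists ([set v | L - e < input_cost v /\
    forall nu, (avg_run_cost nu u <= avg_run_cost nu v + e%:E)%E],
  [set k | (c%:E < avg_run_cost (mu_ k) u)%E]); first by split.
move=> [v k] [/= [Lv uv] ck]; rewrite avg_costE.
have -> : a = (L - e) + (c - e).
  rewrite addrACA -opprD /e -splitr; apply/eqP.
  by rewrite opprB addrC subrK.
rewrite EFinD; apply: lte_leD => //.
by rewrite EFinB leeBlDr//; apply: le_trans (ltW ck) (uv _).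
Qed.

End limit.

(** This is the liminf inequality for the constant sequence [nu], read at one large index. *)
Lemma avg_cost_lsc nu :
  lower_semicontinuous (fun u => avg_cost f lu l0 F xbar0 u nu).
Proof.
move=> u a au; have [[V W] [/= Vu [m _ mW]] VW] :=
  @avg_cost_liminf nu (fun=> nu) (fun _ _ => cvg_cst _) (fun=> cvg_cst _) u a au.
exists V => // v Vv; apply: (VW (v, m)); split => //=; exact: mW (leqnn m).
Qed.

(** All other costs being nonnegative, [r (u i)] bounds the total cost from below at every [th],
    hence also its average. Each coordinate then stays in one compact set, and Tychonoff's theorem
    applies. *)
Lemma avg_cost_coercive :
  (exists r : U -> R, [/\ forall u : U, 0 <= r u, coercive (EFin \o r) &
     forall x (u : U) th, r u <= stage_cost lu l0 (x, u, th)]) ->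
  forall t : R, exists2 K : set {ptws 'I_N -> U}, compact K &
    forall nu u, (avg_cost f lu l0 F xbar0 u nu < t%:E)%E -> K u.
Proof.
move=> [r [r0 r_coercive r_le]] t.
exists [set u | forall i, closure [set z | ((r z)%:E < t%:E)%E] (u i)].
  have cK (i : 'I_N) : compact (closure [set z | ((r z)%:E < t%:E)%E]).
    by rewrite -precompactE; exact: r_coercive.
  exact: (tychonoff cK).
move=> nu u ut i; apply: subset_closure => /=; apply: le_lt_trans ut.
have -> : ((r (u i))%:E = \int[nu]_th (cst (r (u i))%:E th))%E.
  by rewrite integral_cst// [X in (_ * X)%E]probability_setT mule1.
apply: ge0_le_integral => //.
- by move=> th _; rewrite lee_fin.
- apply/measurable_EFinP; under eq_fun do rewrite total_costE.
  by apply: measurable_funD => //; exact: measurable_run_cost.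
- move=> th _; rewrite lee_fin.
  rewrite (le_trans (r_le (traj f u (xbar0 th) th i) _ th))//.
  rewrite /total_cost (bigD1 i)//= -addrA lerDl addr_ge0// sumr_ge0// => n _.
  by rewrite addr_ge0.
Qed.

End averaged_cost.

Theorem corollary10 (R : realType) (X U Theta : pmetricType R)
  (N : nat) (hN : (0 < N)%N)
  (f : X * U * Theta -> X)
  (lu : U -> R) (l0 : X * U * Theta -> R) (F : X * Theta -> R)
  (lu_ge0 : forall u, 0 <= lu u)
  (l0_ge0 : forall z, 0 <= l0 z)
  (F_ge0 : forall z, 0 <= F z)
  (mu : probability (borel Theta) R)
  (mu_ : nat -> probability (borel Theta) R)
  (mu_cvg : weak_cvg mu_ mu)
  (xbar0 : Theta -> X)
  (xbar0_meas : measurable_fun setT (xbar0 : borel Theta -> borel X))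
  (* (1) *)
  (f_mod : exists ax au : R -> R, [/\ class_Kinfty ax, class_Kinfty au &
     forall th x x' u u', mdist (f (x, u, th)) (f (x', u', th))
                          <= ax (mdist x x') + au (mdist u u')])
  (* (2) *)
  (l0_mod : exists gx gu : R -> R, [/\ class_Kinfty gx, class_Kinfty gu &
     forall x x' u u' th, `|l0 (x, u, th) - l0 (x', u', th)|
                          <= gx (mdist x x') + gu (mdist u u')])
  (lu_lsc : lower_semicontinuous (EFin \o lu))
  (F_mod : exists2 gN : R -> R, class_Kinfty gN &
     forall x x' th, `|F (x, th) - F (x', th)| <= gN (mdist x x'))
  (* (3) *)
  (xbar0_cont : continuous xbar0) (f_cont : continuous f)
  (l0_cont : continuous l0) (F_cont : continuous F)
  (* (4) *)
  (l0_cvg : forall (u : {ptws 'I_N -> U}) (n : 'I_N),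
     (\int[mu_ k]_th (l0 (traj f u (xbar0 th) th n, u n, th))%:E)%E
       @[k --> \oo]
     --> (\int[mu]_th (l0 (traj f u (xbar0 th) th n, u n, th))%:E)%E)
  (F_cvg : forall u : {ptws 'I_N -> U},
     (\int[mu_ k]_th (F (traj f u (xbar0 th) th N, th))%:E)%E
       @[k --> \oo]
     --> (\int[mu]_th (F (traj f u (xbar0 th) th N, th))%:E)%E)
  (* (5) *)
  (l_coercive : exists r : U -> R,
     [/\ forall u, 0 <= r u, coercive (EFin \o r) &
         forall x u th, r u <= stage_cost lu l0 (x, u, th)]) :
  let J (nu : probability (borel Theta) R) (u : {ptws 'I_N -> U}) : \bar R :=
    avg_cost f lu l0 F xbar0 u nu in
  [/\ ereal_inf (range (J (mu_ k))) @[k --> \oo] --> ereal_inf (range (J mu)),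
      forall k, exists u, minimiser (J (mu_ k)) u &
      forall u_ : nat -> {ptws 'I_N -> U},
        (forall k, minimiser (J (mu_ k)) (u_ k)) ->
        (* necessary when the integrals in (4) may be infinite; it holds as
           soon as the limits in (4) are real *)
        ((ereal_inf (range (J mu)) < +oo)%E -> precompact (range u_)) /\
        (forall ustar, subseq_limit u_ ustar -> minimiser (J mu) ustar)].

Proof.
move=> J.
have coerciveJ := @avg_cost_coercive R X U Theta N f lu l0 F lu_ge0 l0_ge0 F_ge0
  xbar0 xbar0_cont f_cont l0_cont F_cont l_coercive.
have cvgJ (u : {ptws 'I_N -> U}) : J (mu_ k) u @[k --> \oo] --> J mu u.
  exact: avg_cost_cvg.
have coercive_ (t : R) : exists2 K, compact K &
    forall k u, (J (mu_ k) u < t%:E)%E -> K u.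
  by have [K cK JK] := coerciveJ t; exists K => // k u; exact: JK.
have liminfJ (u : {ptws 'I_N -> U}) (a : R) : (a%:E < J mu u)%E ->
    \forall v \near u & k \near \oo, (a%:E < J (mu_ k) v)%E.
  exact: avg_cost_liminf.
split.
- exact: inf_cvg.
(* The constant input at the distinguished point of [U] witnesses that the input space is
   nonempty. *)
- move=> k; apply: (@lsc_coercive_minimiser R {ptws 'I_N -> U} _ (fun=> point)).
  + exact: avg_cost_lsc.
  + by move=> u; exact: avg_cost_ge0.
  + by move=> t; have [K cK JK] := coerciveJ t; exists K => // u; exact: JK.
- move=> u_ min_u; split.
  + apply: (minimisers_precompact (fun k => J (mu_ k)) (J mu)) => //.
    by apply: (@hausdorff_product _ (fun=> U)) => i; exact: metric_hausdorff.
  + by move=> ustar; apply: (subseq_limit_minimiser (fun k => J (mu_ k)) (J mu)).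
Qed.
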